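(* Let $\{\chi_{n,m}\}_{n\in\mathbb{N},\,m\le n}$ be a collection of independent, mean-zero random elements of $H=L^2([0,1],\mathcal{B}([0,1]),\mu)$ as described in the context. If there exists $\delta>0$ such that $\lim_{n\to\infty}\sum_{m=1}^n\mathbb{E}_{n,m}\big[\|\chi_{n,m}\|_{L^2(\mu)}^{2+\delta}\big]=0$, then for every $\varepsilon>0$, $$\lim_{n\to\infty}\sum_{m=1}^n\mathbb{E}_{n,m}\big[\|\chi_{n,m}\|_{L^2(\mu)}^2 : \|\chi_{n,m}\|_{L^2(\mu)}>\varepsilon\big]=0.$$
   Context: $\mu$ is Lebesgue measure on $[0,1]$ and $H=L^2([0,1],\mathcal{B}([0,1]),\mu)$ is the real separable Hilbert space. $\{\chi_{n,m}\}_{n\in\mathbb{N},\,m\le n}$ is a collection of independent random elements of $H$; $\chi_{n,m}:\Omega\times[0,1]\to\mathbb{R}$ is defined on the probability space $(\Omega,\mathcal{F},P_{n,m})$, where $\Omega$ is separable, and $\mu$ is independent of $P_{n,m}$. $\mathbb{E}_{n,m}$ denotes expectation (Bochner integral) under $P_{n,m}$. It is assumed that $\mathbb{E}_{n,m}[\chi_{n,m}(w,\cdot)]=\mathbf{0}$ and $\int_{\Omega\times[0,1]^2}|\chi_{n,m}(w,x)\chi_{n,m}(w,y)|\,d(P_{n,m}\times\mu\times\mu)<\infty$ for all $n\in\mathbb{N}$, $m\le n$. For a random variable $X$ and an event $A$, $\mathbb{E}[X:A]$ denotes $\mathbb{E}[X\mathbb{1}_A]$. *)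

(* Defs.v *)
From mathcomp Require Import all_boot all_order all_algebra.
From mathcomp Require Import finmap.
From mathcomp Require Import all_classical all_reals all_analysis.

Set Implicit Arguments.
Unset Strict Implicit.
Unset Printing Implicit Defensive.

Import Order.TTheory GRing.Theory Num.Theory.
Import numFieldNormedType.Exports.

Local Open Scope classical_set_scope.
Local Open Scope ring_scope.
Local Open Scope ereal_scope.

Lemma measurable_itv01 (R : realType) :
  measurable ([set` `[0%R, 1%R]] : set (measurableTypeR R)).
Proof. exact: measurable_itv. Qed.

Lemma lebesgue01_lty (R : realType) :
  (@lebesgue_measure R) [set` `[0%R, 1%R] : interval R] < +oo.
Proof. by rewrite lebesgue_measure_itv /= lte_fin ltr01 sube0 ltry. Qed.

(** Lebesgue measure on [0,1], carried by the Borel space R: points outside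
    [0,1] form a null set, so the values taken there by a function are
    immaterial for the L2 norm. *)
Definition leb01 (R : realType) : {finite_measure set (measurableTypeR R) -> \bar R} :=
  mfrestr (@measurable_itv01 R) (@lebesgue01_lty R).

(** The real Hilbert space L2([0,1]), through representatives: the library
    gives the type of square-integrable functions its vector-space structure
    but not the quotient by a.e. equality.  Every notion below depends on an
    element only through the L2 seminorm of its differences with others, hence
    is invariant under a.e. equality. *)
Notation L2 R := (LfunType (leb01 R) (lee1n 2)).

Definition L2norm (R : realType) (f : L2 R) : R :=
  fine 'N[leb01 R]_2[EFin \o f].

Definition L2open (R : realType) : set (set (L2 R)) :=
  [set U | forall f, U f -> exists2 r : R, (0 < r)%R &
    forall g, (L2norm (g - f) < r)%R -> U g].

Definition L2borel (R : realType) : set (set (L2 R)) := <<s @L2open R >>.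

Definition random_element (R : realType) d (T : measurableType d)
    (X : T -> L2 R) : Prop :=
  forall B, L2borel B -> measurable (X @^-1` B).

(** Mutual independence under [P] of the random elements [X i], [i] in [D]. *)
Definition independent_elements (R : realType) d (T : measurableType d)
    (P : probability T R) (I : choiceType) (D : set I) (X : I -> T -> L2 R) :=
  forall (J : {fset I}), [set` J] `<=` D ->
  forall B : I -> set (L2 R), (forall i, i \in J -> L2borel (B i)) ->
  P (\bigcap_(i in [set` J]) X i @^-1` B i) =
  \prod_(i <- J) P (X i @^-1` B i).

Record L2simple (R : realType) d (T : measurableType d) := L2Simple {
  simple_size : nat ;
  simple_set : 'I_simple_size -> set T ;
  simple_set_measurable : forall i, measurable (simple_set i) ;
  simple_val : 'I_simple_size -> L2 R }.

Arguments simple_set {R d T} s i : rename.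
Arguments simple_val {R d T} s i : rename.

Definition simple_eval (R : realType) d (T : measurableType d)
    (s : L2simple R T) (w : T) : L2 R :=
  (\sum_(i < simple_size s)
     (\1_(simple_set s i) w : R) *: simple_val s i)%R.

Definition simple_integral (R : realType) d (T : measurableType d)
    (P : probability T R) (s : L2simple R T) : L2 R :=
  (\sum_(i < simple_size s) fine (P (simple_set s i)) *: simple_val s i)%R.

(** [X] is Bochner integrable under [P], with Bochner integral [v]. *)
Definition is_bochner_integral (R : realType) d (T : measurableType d)
    (P : probability T R) (X : T -> L2 R) (v : L2 R) : Prop :=
  exists s : nat -> L2simple R T,
    [/\ {ae P, forall w,
          L2norm (X w - simple_eval (s j) w)%R @[j --> \oo] --> (0 : R)%R},
        (\int[P]_w (L2norm (X w - simple_eval (s j) w)%R)%:E) @[j --> \oo]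
          --> 0%E &
        L2norm (simple_integral P (s j) - v)%R @[j --> \oo] --> (0 : R)%R].

(** A measurable space is separable when its sigma-algebra is countably
    generated. *)
Definition separable_measurable d (T : measurableType d) : Prop :=
  exists2 G : set (set T), countable G & @measurable d T = <<s G >>.

(** E[X : A] = E[X 1_A] *)
Definition expectation_on (R : realType) d (T : measurableType d)
    (P : probability T R) (X : T -> R) (A : set T) : \bar R :=
  'E_P[X \* \1_A].

(* Main.v *)
(* On the event [||X|| > eps] one has [||X||^2 <= eps^(-delta) ||X||^(2+delta)],
   so each truncated second moment is at most [eps^(-delta)] times the
   corresponding moment of order [2 + delta]; sum over [m] and squeeze. *)

Require Import Defs.
From mathcomp Require Import all_boot all_order all_algebra.
From mathcomp Require Import all_classical all_reals all_analysis.
From mathcomp Require Import measurable_realfun.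
Import Order.TTheory GRing.Theory Num.Theory.
Import numFieldNormedType.Exports.

Local Open Scope classical_set_scope.
Local Open Scope ring_scope.
Local Open Scope ereal_scope.

Lemma L2norm_ge0 (R : realType) (f : L2 R) : (0 <= L2norm f)%R.
Proof. by rewrite fine_ge0 ?Lnorm_ge0. Qed.

Lemma L2normN (R : realType) (f : L2 R) : L2norm (- f)%R = L2norm f.
Proof. exact: LnormrN. Qed.

(** Minkowski's inequality for [f = g + (f - g)]; the difference is then reversed to match the balls
    in [L2open]. *)
Lemma L2norm_le_add_dist (R : realType) (f g : L2 R) :
  (L2norm f <= L2norm g + L2norm (g - f))%R.
Proof.
rewrite -[L2norm (g - f)%R]L2normN opprB -{1}[f](subrKC g).
exact: ler_LnormD.
Qed.

(** The ball around [f] of radius [L2norm f - a] stays inside the set, by the triangle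
    inequality. *)
Lemma L2open_L2norm_gt (R : realType) (a : R) :
  L2open [set f | (a < L2norm f)%R].
Proof.
move=> f /= af; exists (L2norm f - a)%R; first by rewrite subr_gt0.
move=> g; rewrite ltrBrDl -ltrBrDr => /lt_le_trans; apply.
by rewrite lerBlDr L2norm_le_add_dist.
Qed.

(** The rays []a, +oo[] generate the Borel sets of [R], and their preimages under the norm are open,
    hence in [L2borel]. *)
Lemma measurable_L2norm (R : realType) d (T : measurableType d)
    (X : T -> L2 R) :
  random_element X -> measurable_fun [set: T] (fun w => L2norm (X w)).
Proof.
move=> rX; apply: (measurability _ (RGenOInfty.measurableE R)) => //.
move=> /= _ [_ [a ->] <-]; rewrite setTI preimage_itvoy.
by apply: (rX [set f | (a < L2norm f)%R]); apply: sub_gen_smallest;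
  exact: L2open_L2norm_gt.
Qed.

(** The scalar core of the argument: the Hilbert space enters only through a nonnegative measurable
    [Y]. Both sides are integrals of nonnegative functions, so the moment on the right may be
    [+oo]. *)
Lemma expectation_on_sqr_le (R : realType) d (T : measurableType d)
    (P : probability T R) (Y : T -> R) (delta eps : R) :
  measurable_fun [set: T] Y -> (forall w, 0 <= Y w)%R ->
  (0 < delta)%R -> (0 < eps)%R ->
  expectation_on P (fun w => Y w ^+ 2)%R [set w | (eps < Y w)%R] <=
  (eps `^ (- delta))%:E * 'E_P[fun w => (Y w `^ (2 + delta))%R].
Proof.
move=> mY Y0 delta0 eps0.
have mYp : measurable_fun [set: T] (fun w => Y w `^ (2 + delta))%R.
  exact: (measurableT_comp (measurable_powR _)).
have mtail : measurable [set w | (eps < Y w)%R].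
  rewrite -[X in measurable X]setTI.
  have -> : [set w | (eps < Y w)%R] = Y @^-1` `]eps, +oo[.
    by rewrite preimage_itvoy.
  exact: mY.
rewrite /expectation_on unlock -ge0_integralZl//; first last.
- by rewrite lee_fin powR_ge0.
- by move=> w _; rewrite lee_fin powR_ge0.
- exact/measurable_EFinP.
apply: ge0_le_integral => //=.
- by move=> w _; rewrite lee_fin mulr_ge0// exprn_ge0.
- apply/measurable_EFinP; apply: measurable_funM; first exact: measurable_funX.
  exact: measurable_indic.
- by apply/measurable_EFinP; apply: measurable_funM => //.
move=> w _; rewrite -EFinM lee_fin indicE.
(* Off the tail event the indicator makes the left side zero. *)
have [/set_mem/= epsY|_] := boolP (w \in _); last first.
  by rewrite mulr0 mulr_ge0// powR_ge0.
have Yw0 : (0 < Y w)%R by exact: lt_trans epsY.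
(* Splitting the exponent is safe because the base [Y w] is nonzero. *)
rewrite mulr1 powRD; last by rewrite (gt_eqF Yw0) implybT.
(* With [Y w ^+ 2] factored out, it remains to bound [eps]^ (- delta) * Y w [^ delta] below by 1,
   which is monotonicity of the power [delta] at [eps < Y w]. *)
rewrite -[(2 : R)%R]/(2%:R)%R powR_mulrn// mulrCA ler_peMr ?exprn_ge0//.
rewrite powRN mulrC ler_pdivlMr ?powR_gt0// mul1r.
by apply: ge0_ler_powR => //; rewrite ?nnegrE ltW.
Qed.

Theorem theorem2 (R : realType)
  (d : measure_display) (Omega : measurableType d)
  (Omega_sep : separable_measurable Omega)
  (P : nat -> nat -> probability Omega R)
  (chi : nat -> nat -> Omega -> L2 R)
  (chi_random : forall n m : nat, (1 <= m <= n)%N -> random_element (chi n m))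
  (d' : measure_display) (W : measurableType d') (Q : probability W R)
  (proj : nat -> nat -> {RV Q >-> Omega})
  (proj_law : forall n m : nat, (1 <= m <= n)%N ->
     forall A : set Omega, measurable A -> distribution Q (proj n m) A = P n m A)
  (chi_indep : independent_elements Q
     [set nm : nat * nat | (1 <= nm.2 <= nm.1)%N]
     (fun nm => chi nm.1 nm.2 \o proj nm.1 nm.2))
  (chi_mean0 : forall n m : nat, (1 <= m <= n)%N ->
     is_bochner_integral (P n m) (chi n m) 0%R)
  (chi_cov : forall n m : nat, (1 <= m <= n)%N ->
     ((P n m \x leb01 R) \x leb01 R).-integrable setT
       (fun z => `|chi n m z.1.1 z.1.2 * chi n m z.1.1 z.2|%:E)) :
  (exists2 delta : R, (0 < delta)%R &
     (\sum_(1 <= m < n.+1)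
        'E_(P n m)[fun w => (L2norm (chi n m w) `^ (2 + delta))%R])
       @[n --> \oo] --> 0) ->
  forall eps : R, (0 < eps)%R ->
     (\sum_(1 <= m < n.+1)
        expectation_on (P n m) (fun w => (L2norm (chi n m w) ^+ 2)%R)
          [set w | (eps < L2norm (chi n m w))%R])
       @[n --> \oo] --> 0.
Proof.
move=> [delta delta0 lyapunov] eps eps0.
have lyapunovZ := cvgeZl (y := (eps `^ (- delta))%:E) isT lyapunov.
rewrite mule0 in lyapunovZ.
apply: (squeeze_cvge _ (cvg_cst 0) lyapunovZ).
apply: nearW => n; apply/andP; split.
  apply: sume_ge0 => m _; apply: expectation_ge0 => w /=.
  by rewrite mulr_ge0// exprn_ge0// L2norm_ge0.
(* In the extended reals, distributing the constant over the sum uses that the moments are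
   nonnegative. *)
rewrite ge0_sume_distrr; last first.
  by move=> m _; apply: expectation_ge0 => w; exact: powR_ge0.
(* [big_nat] keeps the range of [m] as a hypothesis, which [chi_random] requires. *)
rewrite !big_nat; apply: lee_sum => m nm.
apply: expectation_on_sqr_le => //; last by move=> w; exact: L2norm_ge0.
exact/measurable_L2norm/chi_random.
Qed.
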